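(* Let $K, L \subset \mathbb{R}^d$ be convex bodies containing the origin in their interiors with $K \subseteq L$, and let $F$ be a linear subspace of $\mathbb{R}^d$. Assume that $K$ is a largest-volume member of $\mathcal{A}_F(K)$ contained in $L$, i.e. $\mathrm{vol}(K)\ge \mathrm{vol}(K')$ for every $K'\in\mathcal{A}_F(K)$ with $K'\subseteq L$. Then there exist contact pairs $(v_1,p_1),\dots,(v_m,p_m)$ of $K$ and $L$ and positive weights $\alpha_1,\dots,\alpha_m$ such that \[ P_F\Big(\sum_{i=1}^m \alpha_i\, p_i\otimes v_i\Big)P_F = P_F,\qquad \sum_{i=1}^m \alpha_i p_i = 0,\qquad \operatorname{tr}\Big(\sum_{i=1}^m \alpha_i\, p_i\otimes v_i\Big)=\sum_{i=1}^m\alpha_i = d. \]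
   Context: A convex body is a compact convex set with nonempty interior. For a linear subspace $F\subseteq\mathbb{R}^d$, an $F$-operator is an invertible linear operator $A$ on $\mathbb{R}^d$ such that $F$ and $F^\perp$ are invariant subspaces of $A$ and the restriction of $A$ to $F^\perp$ is a nonzero multiple of the identity on $F^\perp$. For $S\subseteq\mathbb{R}^d$, $\mathcal{A}_F(S)=\{AS+z:\ A \text{ an } F\text{-operator},\ z\in\mathbb{R}^d\}$. $P_F$ denotes orthogonal projection onto $F$. The polar of a set $S$ is $S^\circ=\{p:\ \langle x,p\rangle\le 1\ \forall x\in S\}$. For convex bodies $K\subseteq L$, a contact pair of $K$ and $L$ is a pair $(v,p)\in\mathbb{R}^d\times\mathbb{R}^d$ with $v\in\partial K\cap\partial L$, $p\in\partial K^\circ\cap\partial L^\circ$, and $\langle p,v\rangle=1$ (so $p$ is a suitably normalized outer normal of a common supporting hyperplane of $K$ and $L$ at $v$). For vectors $p,v$, $p\otimes v$ is the linear operator $x\mapsto\langle v,x\rangle p$. *)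

(* Defs.v *)
(* R^d is modelled as row vectors 'rV[R]_d;
   linear operators act on the right: the operator A maps x to x *m A. *)
From HB Require Import structures.
From mathcomp Require Import all_boot all_order all_algebra.
From mathcomp Require Import all_classical all_reals all_analysis.
Set Implicit Arguments. Unset Strict Implicit. Unset Printing Implicit Defensive.
Import Order.TTheory GRing.Theory Num.Theory.
Import numFieldNormedType.Exports.
Local Open Scope classical_set_scope.
Local Open Scope ring_scope.

Section Defs.
Variables (R : realType) (d : nat).
Notation vec := 'rV[R]_d.

Definition dotv (x y : vec) : R := \sum_(i < d) x 0 i * y 0 i.

Definition is_convex (S : set vec) : Prop :=
  @convex_set R (convex_lmodType vec) S.

Definition convex_body (S : set vec) : Prop :=
  compact S /\ is_convex S /\ (S° !=set0).

Definition bd (S : set vec) : set vec := closure S `\` S°.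

Definition polar (S : set vec) : set vec :=
  [set p | forall x, S x -> dotv x p <= 1].

(* a linear subspace F is given as the row space of a matrix F : 'M_d *)
Definition in_sub (F : 'M[R]_d) (x : vec) : Prop := (x <= F)%MS.

Definition in_perp (F : 'M[R]_d) (x : vec) : Prop :=
  forall y, in_sub F y -> dotv x y = 0.

Definition orth_proj (F P : 'M[R]_d) : Prop :=
  forall x : vec, in_sub F (x *m P) /\ in_perp F (x - x *m P).

Definition F_operator (F A : 'M[R]_d) : Prop :=
  A \in unitmx /\
  (forall x, in_sub F x -> in_sub F (x *m A)) /\
  (forall x, in_perp F x -> in_perp F (x *m A)) /\
  (exists c : R, c != 0 /\ forall x, in_perp F x -> x *m A = c *: x).

Definition aff_image (A : 'M[R]_d) (z : vec) (S : set vec) : set vec :=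
  (fun x => x *m A + z) @` S.

Definition A_F (F : 'M[R]_d) (S : set vec) : set (set vec) :=
  [set T | exists A z, F_operator F A /\ T = aff_image A z S].

Definition box (a b : vec) : set vec :=
  [set x | forall i, a 0 i <= x 0 i <= b 0 i].
Definition box_vol (a b : vec) : R := \prod_(i < d) (b 0 i - a 0 i).
Definition vol (S : set vec) : \bar R :=
  ereal_inf [set s | exists (a b : nat -> vec),
    (forall n i, a n 0 i <= b n 0 i) /\
    S `<=` \bigcup_n box (a n) (b n) /\
    s = (\sum_(0 <= n <oo) (box_vol (a n) (b n))%:E)%E].

(* p (x) v : the operator x |-> <v, x> p ; as a right-acting matrix *)
Definition tens (p v : vec) : 'M[R]_d := (v^T *m p).

Definition contact_pair (K L : set vec) (v p : vec) : Prop :=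
  bd K v /\ bd L v /\ bd (polar K) p /\ bd (polar L) p /\ dotv p v = 1.

End Defs.

(* Main.v *)
Require Import Defs.
From HB Require Import structures.
From mathcomp Require Import all_boot all_order all_algebra.
From mathcomp Require Import ring lra.
From mathcomp Require Import all_classical all_reals all_analysis.
From mathcomp Require Import measurable_realfun.
From mathcomp Require polyrcf.
Import Order.TTheory GRing.Theory Num.Theory.
Import numFieldNormedType.Exports.
Local Open Scope classical_set_scope.
Local Open Scope ring_scope.

(** The conclusion says that [(P/d, 0)] lies in the convex hull of the points
    [(P (p (x) v) P, p)], [(v, p)] ranging over the contact pairs; the trace
    condition then holds because [<p, v> = 1].  By Caratheodory this hull is
    compact, so otherwise some [(H, z)] satisfies
    [<p, v P H P> + <p, z> > tr (P H P) / d] on all contact pairs.  Choose [c]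
    slightly above [tr (P H P) / d] and put [H' = P H P - c].  For small [t > 0]
    the map [x |-> x - t (x H' + z)] has an [F]-operator of determinant [> 1] as
    linear part, since [tr H' < 0], and sends [K] into [L]: by the bipolar
    theorem this is the inequality [<p, x> - t <p, x H' + z> <= 1] on the
    compact set [K * polar L], clear wherever [<p, x H' + z>] is nonnegative,
    while elsewhere [<p, x>] stays away from [1].  This contradicts the
    maximality of the volume of [K].

    That [vol] is multiplied by [|det A|] is needed only for [A] close to the
    identity, where [A] is a product of matrices differing from the identity in
    a single row. *)

(** * Euclidean geometry of row vectors *)

Section Euclidean.
Set Implicit Arguments.
Unset Strict Implicit.
Variables (R : realType) (n : nat).
Implicit Types (x y z p q : 'rV[R]_n) (S : set 'rV[R]_n).

Lemma dotvC x y : dotv x y = dotv y x.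
Proof. by apply: eq_bigr => i _; rewrite mulrC. Qed.

Lemma dotvDl x y z : dotv (x + y) z = dotv x z + dotv y z.
Proof. by rewrite -big_split; apply: eq_bigr => i _; rewrite mxE mulrDl. Qed.

Lemma dotvZl (a : R) x y : dotv (a *: x) y = a * dotv x y.
Proof. by rewrite big_distrr; apply: eq_bigr => i _; rewrite /= mxE mulrA. Qed.

Lemma dotvNl x y : dotv (- x) y = - dotv x y.
Proof. by rewrite -scaleN1r dotvZl mulN1r. Qed.

Lemma dotvBl x y z : dotv (x - y) z = dotv x z - dotv y z.
Proof. by rewrite dotvDl dotvNl. Qed.

Lemma dotvDr x y z : dotv z (x + y) = dotv z x + dotv z y.
Proof. by rewrite !(dotvC z) dotvDl. Qed.

Lemma dotvZr (a : R) x y : dotv y (a *: x) = a * dotv y x.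
Proof. by rewrite !(dotvC y) dotvZl. Qed.

Lemma dotvNr x y : dotv y (- x) = - dotv y x.
Proof. by rewrite !(dotvC y) dotvNl. Qed.

Lemma dotvBr x y z : dotv z (x - y) = dotv z x - dotv z y.
Proof. by rewrite !(dotvC z) dotvBl. Qed.

Lemma dotv0l x : dotv 0 x = 0.
Proof. by rewrite -(scale0r 0) dotvZl mul0r. Qed.

Lemma dotv_mulmx x y : dotv x y = (x *m y^T) 0 0.
Proof. by rewrite mxE; apply: eq_bigr => i _; rewrite mxE. Qed.

Lemma dotv_ge0 x : 0 <= dotv x x.
Proof. by apply: sumr_ge0 => i _; rewrite -expr2 sqr_ge0. Qed.

Lemma dotv_eq0 x : (dotv x x == 0) = (x == 0).
Proof.
apply/eqP/eqP => [/eqP|->]; last by rewrite dotv0l.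
rewrite psumr_eq0 => [/allP x0|i _]; last by rewrite -expr2 sqr_ge0.
apply/rowP => i; rewrite mxE; apply/eqP.
by have := x0 i (mem_index_enum i); rewrite /= mulf_eq0 orbb.
Qed.

Lemma dotv_gt0 x : (0 < dotv x x) = (x != 0).
Proof. by rewrite lt_def dotv_eq0 dotv_ge0 andbT. Qed.

Lemma normr_coord x i : `|x 0 i| <= `|x|.
Proof.
by rewrite [leRHS]/Num.norm/= mx_normrE; apply/bigmax_geP; right; exists (ord0, i).
Qed.

(** Entries may lie in any topological space because the hull argument also uses rows whose entries
    are vectors. *)
Lemma coord_continuous_rV (T : ptopologicalType) m (i : 'I_m) :
  continuous (fun X : 'rV[T]_m => X 0 i).
Proof.
move=> X A XA; exists (fun _ j => if j == i then A else setT).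
  by move=> k j; rewrite ord1; case: eqVneq => [->|_] //; exact: filterT.
by move=> Y /(_ 0 i)/=; rewrite eqxx.
Qed.

Lemma continuous_rV (T : topologicalType) m (f : T -> 'rV[R]_m) :
  (forall i, continuous (fun t => f t 0 i)) -> continuous f.
Proof.
move=> cf t A [P nP PA]; apply: (@filterS _ _ _ [set s | forall i, P 0 i (f s 0 i)]).
  by move=> s Ps; apply: PA => k i; rewrite ord1.
by apply: filter_forall => i; apply: cf; exact: nP.
Qed.

Lemma continuous_coord (T : topologicalType) m (f : T -> 'rV[R]_m) i :
  continuous f -> continuous (fun t => f t 0 i).
Proof.
by move=> cf t A fA; exact: (cf t _ (@coord_continuous_rV _ _ i (f t) _ fA)).
Qed.

Lemma continuous_sumr (T : topologicalType) m (f : 'I_m -> T -> R) :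
  (forall i, continuous (f i)) -> continuous (fun t => \sum_i f i t).
Proof.
elim: m f => [|m IH] f cf.
  by under eq_fun do rewrite big_ord0; exact: cst_continuous.
under eq_fun do rewrite big_ord_recr; move=> t; apply: cvgD; last exact: cf.
exact: IH.
Qed.

Lemma continuous_dotv (T : topologicalType) (f g : T -> 'rV[R]_n) :
  continuous f -> continuous g -> continuous (fun t => dotv (f t) (g t)).
Proof.
move=> cf cg; apply: continuous_sumr => i t; apply: cvgM.
  exact: continuous_coord.
exact: continuous_coord.
Qed.

Lemma continuous_mulmx m (T : topologicalType) (f : T -> 'rV[R]_m) (A : 'M[R]_(m, n)) :
  continuous f -> continuous (fun t => f t *m A).
Proof.
move=> cf; apply: continuous_rV => i.
under eq_fun do rewrite mxE.
apply: continuous_sumr => j t; apply: cvgM; last exact: cvg_cst.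
exact: continuous_coord.
Qed.

(** * Compactness criteria and polars *)

Lemma compact_coord_bounded S (M : R) : closed S ->
  (forall x, S x -> forall i, `|x 0 i| <= M) -> compact S.
Proof.
move=> cS SM; apply: subclosed_compact cS _ _; last first.
  by move=> x /SM xM; exact: xM.
apply: (@rV_compact _ _ (fun=> [set t : R | `|t| <= M])) => _.
rewrite (_ : mkset _ = `[- M, M]%classic); first exact: segment_compact.
by apply/seteqP; split => t /=; rewrite in_itv/= ler_norml.
Qed.

Lemma interior0_cube S : S° 0 ->
  exists2 r : R, 0 < r & forall x, (forall i, `|x 0 i| <= r) -> S x.
Proof.
move=> /nbhs_ballP[e /= e0 eS]; exists (e / 2); first by rewrite divr_gt0.
move=> x xe; apply: eS; split => // k i; rewrite ord1 /ball/= mxE sub0r normrN.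
by apply: le_lt_trans (xe i) _; rewrite ltr_pdivrMr// ltr_pMr// ltr1n.
Qed.

Lemma closed_polar S : closed (polar S).
Proof.
rewrite (_ : polar S = \bigcap_(x in S) (dotv x @^-1` [set t | t <= 1])).
  apply: closed_bigI => x _; apply: closed_comp; last exact: closed_le.
  move=> p _; apply: (@continuous_dotv _ (fun=> x) id); last by move=> ?; exact: cvg_id.
  exact: cst_continuous.
by apply/seteqP; split.
Qed.

(** [S] contains the points [r e_i] and [- r e_i] for some [r > 0]; testing [p] against them bounds
    each coordinate of [p] by [1 / r]. *)
Lemma compact_polar S : S° 0 -> compact (polar S).
Proof.
move=> /interior0_cube[r r0 rS].
apply: (@compact_coord_bounded _ r^-1); first exact: closed_polar.
move=> p pS i; have dotE (s : R) : dotv (s *: delta_mx 0 i) p = s * p 0 i.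
  rewrite dotvZl; congr (_ * _); rewrite /dotv (bigD1 i)//= mxE !eqxx mul1r.
  by rewrite big1 ?addr0// => j ji; rewrite mxE (negPf ji) andbF mul0r.
have sS (s : R) : `|s| <= r -> s * p 0 i <= 1.
  move=> sr; rewrite -dotE; apply: pS; apply: rS => j.
  by rewrite !mxE eqxx; case: eqP => _; rewrite ?mulr1 ?mulr0 ?normr0// ltW.
have pr : r * p 0 i <= 1 by apply: sS; rewrite gtr0_norm.
have pNr : - r * p 0 i <= 1 by apply: sS; rewrite normrN gtr0_norm.
by rewrite -div1r ler_pdivlMr// -[X in _ * X](gtr0_norm r0) -normrM ler_norml; lra.
Qed.

(** * Closest points, separation and supporting functionals *)

Lemma is_convexP S : is_convex S -> forall x y (t : R), 0 <= t <= 1 -> S x -> S y ->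
  S (t *: x + (1 - t) *: y).
Proof.
move=> cS x y t t01 Sx Sy.
by have := cS x y (Itv01 (andP t01).1 (andP t01).2); rewrite !inE; exact.
Qed.

(** The distance is the Euclidean one, written with [dotv], because the norm on row vectors is the
    sup norm. *)
Lemma closest_point S y : compact S -> S !=set0 ->
  exists2 x, S x & forall z, S z -> dotv (x - y) (x - y) <= dotv (z - y) (z - y).
Proof.
move=> cS S0; have [|x xS xmin] := @EVT_min_rV _ _ (fun x => dotv (x - y) (x - y)) _ S0 cS.
  apply: continuous_subspaceT.
  have cy : continuous (fun x : 'rV[R]_n => x - y).
    by move=> x; apply: (@cvgB _ _ _ (nbhs x) _ id (cst y)) => //; exact: cvg_cst.
  exact: continuous_dotv.
by exists x; [exact: set_mem|move=> z Sz; apply: xmin; exact: mem_set].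
Qed.

(** First-order optimality at the end [x] of the segment to [z]. Only this segment is mentioned, so
    that the competitors can later be points of a hull. *)
Lemma closest_point_obtuse x y z :
  (forall t : R, 0 < t <= 1 ->
    dotv (x - y) (x - y) <= dotv (t *: z + (1 - t) *: x - y) (t *: z + (1 - t) *: x - y)) ->
  0 <= dotv (z - x) (x - y).
Proof.
set b := dotv (z - x) (x - y) => xmin; rewrite leNgt; apply/negP => b0.
pose a := dotv (z - x) (z - x); have a0 : 0 <= a := dotv_ge0 _.
have ab : 0 < a - b by rewrite subr_gt0 (lt_le_trans b0).
(* The increment of the squared distance is [t * (2 b + t a)]. Its minimiser would be [- b / a]; the
   denominator [a - b] stays positive even if [a = 0], keeps [t <= 1], and still makes the increment
   negative. *)
pose t := - b / (a - b).
have t01 : 0 < t <= 1.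
  by rewrite divr_gt0 ?oppr_gt0// ler_pdivrMr// mul1r lerDr.
have := xmin t t01.
have -> : t *: z + (1 - t) *: x - y = (x - y) + t *: (z - x).
  by apply/rowP => i; rewrite !mxE; ring.
have expand (u v : 'rV[R]_n) (s : R) : dotv (u + s *: v) (u + s *: v) =
    dotv u u + s * (2 * dotv v u + s * dotv v v).
  by rewrite !(dotvDl, dotvDr, dotvZl, dotvZr) (dotvC u v); ring.
rewrite expand lerDl -/a -/b.
rewrite pmulr_rge0 ?(andP t01).1// -(pmulr_lge0 _ ab) mulrDl.
rewrite (_ : t * a * (a - b) = - b * a); last by rewrite /t; field; rewrite gt_eqF.
by nra.
Qed.

(** The separating functional is [y - x], with [x] the point of [S] closest to [y], divided by its
    maximum [<x, y - x>] over [S]. *)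
Lemma bipolar_separation S y : compact S -> is_convex S -> S° 0 -> ~ S y ->
  exists2 p, polar S p & 1 < dotv p y.
Proof.
move=> cS xS S0 Sy.
have [r r0 rS] := interior0_cube S0.
have [|x Sx xmin] := @closest_point S y cS.
  by exists 0; apply: rS => i; rewrite mxE normr0 ltW.
have obt z : S z -> dotv z (y - x) <= dotv x (y - x).
  move=> Sz; rewrite -subr_le0 -dotvBl -[y - x]opprB dotvNr oppr_le0.
  apply: closest_point_obtuse => t /andP[t0 t1]; apply: xmin.
  by apply: is_convexP => //; rewrite (ltW t0).
have q0 : 0 < dotv (y - x) (y - x).
  by rewrite dotv_gt0 subr_eq0; apply/eqP => yx; apply: Sy; rewrite yx.
(* A small positive multiple of [y - x] lies in [S], so the maximum of this functional over [S] is
   positive. *)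
have c0 : 0 < dotv x (y - x).
  pose s := r / (1 + `|y - x|).
  have M0 : 0 < 1 + `|y - x| by rewrite ltr_pwDl.
  have s0 : 0 < s by rewrite divr_gt0.
  apply: lt_le_trans (obt (s *: (y - x)) _); first by rewrite dotvZl mulr_gt0.
  apply: rS => i; rewrite mxE normrM gtr0_norm// /s -mulrA ger_pMr//.
  rewrite mulrC ler_pdivrMr// mul1r (le_trans (normr_coord _ _))//.
  by rewrite lerDr.
exists ((dotv x (y - x))^-1 *: (y - x)).
  by move=> z Sz; rewrite dotvZr mulrC ler_pdivrMr// mul1r obt.
rewrite dotvZl mulrC ltr_pdivlMr// mul1r (dotvC (y - x) y) -subr_gt0 -dotvBl.
exact: q0.
Qed.

(** If [x] were interior, [(1 + s) x] would lie in [S] for a small [s > 0], where the functional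
    equals [1 + s]. *)
Lemma bd_of_supporting S p x : (forall y, S y -> dotv p y <= 1) -> S x ->
  dotv p x = 1 -> bd S x.
Proof.
move=> Sp Sx px; split; first exact: subset_closure.
move=> /nbhs_ballP[e /= e0 eS].
have M0 : 0 < 1 + `|x| by rewrite ltr_pwDl.
pose s := e / (1 + `|x|); have s0 : 0 < s by rewrite divr_gt0.
have /eS/Sp : ball x e ((1 + s) *: x).
  split => // k i; rewrite ord1 /ball/= mxE mulrDl mul1r opprD addNKr normrN.
  rewrite normrM gtr0_norm// /s -mulrA gtr_pMr// mulrC ltr_pdivrMr// mul1r.
  by rewrite (le_lt_trans (normr_coord _ _))// ltrDr.
by rewrite dotvZr px mulr1 gerDl leNgt s0.
Qed.

End Euclidean.

(** * Convex hulls of compact sets *)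

Section ConvexHull.
Set Implicit Arguments.
Unset Strict Implicit.
Variables (R : realType) (n : nat) (S : set 'rV[R]_n).
Implicit Types (x y : 'rV[R]_n).

(** Fixing the number of points, repetitions allowed, makes the set a continuous image of a compact
    product. *)
Definition hull m : set 'rV[R]_n := [set x |
  exists (a : 'I_m -> R) (X : 'I_m -> 'rV[R]_n), [/\ forall i, 0 <= a i,
    \sum_i a i = 1, forall i, S (X i) & x = \sum_i a i *: X i]].

(** At least [n + 2] points are affinely dependent; subtracting a suitable multiple of the
    dependency from the weights makes one weight vanish and leaves the others nonnegative. *)
Lemma caratheodory_step m x : (n < m)%N -> hull m.+1 x -> hull m x.
Proof.
move=> nm [a [X [a0 a1 SX ->]]].
(* The column of ones forces the coefficients of a kernel vector to sum to zero. *)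
pose W : 'M[R]_(m.+1, n + 1) := row_mx (\matrix_i X i) (const_mx 1).
have kW0 : kermx W != 0.
  rewrite -mxrank_eq0 mxrank_ker -lt0n subn_gt0.
  by rewrite (leq_ltn_trans (rank_leq_col W))// addn1.
pose v := nz_row (kermx W).
have v0 : v != 0 by rewrite nz_row_eq0.
have vW : v *m W = 0 by apply/sub_kermxP/nz_row_sub.
have /eq_row_mx[vX v1] : row_mx (v *m \matrix_i X i) (v *m const_mx 1)
    = row_mx 0 0 :> 'rV[R]_(n + 1) by rewrite -mul_mx_row row_mx0.
have {}vX : \sum_i v 0 i *: X i = 0.
  by rewrite -[RHS]vX mulmx_sum_row; apply: eq_bigr => i _; rewrite rowK.
have {}v1 : \sum_i v 0 i = 0.
  have := congr1 (fun M : 'rV[R]_1 => M 0 0) v1; rewrite !mxE => H.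
  by rewrite -[RHS]H; apply: eq_bigr => i _; rewrite mxE mulr1.
have [i0 vi0] : exists i, 0 < v 0 i.
  apply: contrapT => /forallNP vle; move/eqP: v0; apply.
  apply/rowP => k.
  have {}vle j : v 0 j <= 0 by rewrite leNgt; apply/negP/vle.
  have /psumr_eq0P v0 : \sum_j - v 0 j = 0 by rewrite sumrN v1 oppr0.
  by rewrite mxE -[LHS]opprK v0 ?oppr0// => j _; rewrite oppr_ge0.
(* The least ratio is the largest [t] for which all [a j - t * v 0 j] remain nonnegative. *)
have [/= i vi imin] :=
  @arg_minP _ _ _ i0 (fun i => 0 < v 0 i) (fun i => a i / v 0 i) vi0.
pose t := a i / v 0 i; have t0 : 0 <= t by rewrite divr_ge0// ltW.
pose b j := a j - t * v 0 j.
have bi : b i = 0 by rewrite /b /t divfK ?subrr// gt_eqF.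
have b0 j : 0 <= b j.
  rewrite subr_ge0; have [vj|vj] := ltP 0 (v 0 j).
    by rewrite -ler_pdivlMr//; exact: imin.
  by rewrite (le_trans _ (a0 j))// mulr_ge0_le0.
exists (b \o lift i), (X \o lift i); split=> [j|||].
- exact: b0.
- transitivity (\sum_j b j); first by rewrite (bigD1_ord i)//= bi add0r.
  by rewrite sumrB -mulr_sumr v1 mulr0 subr0.
- by move=> j; exact: SX.
- transitivity (\sum_j b j *: X j); last first.
    by rewrite (bigD1_ord i)//= bi scale0r add0r.
  rewrite [RHS](eq_bigr (fun j => a j *: X j - t *: (v 0 j *: X j))); last first.
    by move=> j _; rewrite scalerBl scalerA.
  by rewrite sumrB -scaler_sumr vX scaler0 subr0.
Qed.

Lemma compact_hull m : compact S -> compact (hull m).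
Proof.
move=> cS.
pose simplex : set 'rV[R]_m := [set a | (forall i, 0 <= a 0 i) /\ \sum_i a 0 i = 1].
have csimplex : compact simplex.
  apply: (@compact_coord_bounded _ _ _ 1).
    rewrite (_ : simplex = (\bigcap_i ((fun a : 'rV[R]_m => a 0 i) @^-1` [set t | 0 <= t]))
        `&` ((fun a : 'rV[R]_m => \sum_i a 0 i) @^-1` [set 1])); last first.
      apply/seteqP; split => [a [a0 a1]|a [a0 a1]]; split => //.
        by move=> i _; exact: a0.
      by move=> i; exact: (a0 i I).
    apply: closedI.
      apply: closed_bigI => i _; apply: closed_comp; last exact: closed_ge.
      by move=> a _; exact: coord_continuous_rV.
    apply: closed_comp; last exact: closed_eq.
    move=> a _; apply: continuous_sumr => i; exact: coord_continuous_rV.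
  move=> a [a0 a1] i; rewrite ger0_norm// -a1 (bigD1 i)//= lerDl.
  exact: sumr_ge0.
(* The power of [S] is encoded as rows of vectors, so that Tychonoff for rows applies. *)
pose SX : set 'rV['rV[R]_n]_m := [set X | forall i, S (X 0 i)].
have cSX : compact SX := @rV_compact _ _ (fun=> S) (fun=> cS).
pose f (aX : 'rV[R]_m * 'rV['rV[R]_n]_m) : 'rV[R]_n := \sum_i aX.1 0 i *: aX.2 0 i.
have -> : hull m = f @` (simplex `*` SX).
  apply/seteqP; split => [_ [a [X [a0 a1 SXi ->]]]|_ [[a X] [[a0 a1] SXi] <-]].
    exists (\row_i a i, \row_i X i).
      split; last by move=> i; rewrite mxE.
      split=> [i|]; first by rewrite mxE.
      by rewrite -[RHS]a1; apply: eq_bigr => i _; rewrite mxE.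
    by apply: eq_bigr => i _; rewrite !mxE.
  by exists (fun i => a 0 i), (fun i => X 0 i).
apply: continuous_compact; last exact: compact_setX.
apply: continuous_subspaceT; apply: continuous_rV => j.
under eq_fun do rewrite summxE; apply: continuous_sumr => i.
under eq_fun do rewrite mxE.
have c1 : continuous (fun aX : 'rV[R]_m * 'rV['rV[R]_n]_m => aX.1).
  by move=> aX; exact: cvg_fst.
have c2 : continuous (fun aX : 'rV[R]_m * 'rV['rV[R]_n]_m => aX.2 0 i).
  move=> aX A fA; have c2 : snd @ nbhs aX --> nbhs aX.2 by exact: cvg_snd.
  exact: (c2 _ (@coord_continuous_rV _ _ i aX.2 _ fA)).
move=> aX; apply: cvgM; first exact: (continuous_coord c1).
exact: (continuous_coord c2).
Qed.

(* With [n.+1] points allowed the hull is compact, so [x] has a closest point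
   [y] in it; Caratheodory lets the segment from [y] to a point of [S] be used
   as a competitor. *)
Lemma hull_of_support x : compact S ->
  (forall h, exists2 s, S s & dotv h s <= dotv h x) -> hull n.+1 x.
Proof.
move=> cS Sx; have [s0 Ss0 _] := Sx 0.
have [|y hy ymin] := @closest_point _ _ (hull n.+1) x (compact_hull cS).
  exists s0, (fun i => (i == ord0)%:R), (fun=> s0); split => //.
    by rewrite (bigD1 ord0)//= big1 ?addr0// => i /negPf->.
  by rewrite (bigD1 ord0)//= scale1r big1 ?addr0// => i /negPf->; rewrite scale0r.
have [<-//|yx] := eqVneq y x.
(* The functional [y - x] gives [<y - x, s - x> <= 0], while optimality of [y] gives
   [<s - y, y - x> >= 0], hence [<s - x, y - x> >= <y - x, y - x> > 0]. *)
have [s Ss] := Sx (y - x).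
rewrite -subr_le0 -dotvBr leNgt => /negP; case.
rewrite (_ : s - x = (s - y) + (y - x)); last by rewrite addrA subrK.
rewrite dotvDr ltr_wpDl//; last by rewrite dotv_gt0 subr_eq0.
rewrite dotvC; apply: closest_point_obtuse => t /andP[t0 t1]; apply: ymin.
apply: caratheodory_step => //.
have [a [X [a0 a1 SX ->]]] := hy.
(* The new point [s] takes slot [0] with weight [t]; the old weights are scaled by [1 - t]. *)
exists (fun i => if unlift ord0 i is Some j then (1 - t) * a j else t).
exists (fun i => if unlift ord0 i is Some j then X j else s); split.
- by move=> i; case: unliftP => [j _|_]; rewrite ?mulr_ge0 ?subr_ge0// ltW.
- rewrite big_ord_recl unlift_none; under eq_bigr do rewrite liftK.
  by rewrite -mulr_sumr a1 mulr1 subrKC.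
- by move=> i; case: unliftP.
- rewrite [RHS]big_ord_recl unlift_none; congr (_ + _).
  by rewrite scaler_sumr; apply: eq_bigr => i _; rewrite liftK scalerA.
Qed.

End ConvexHull.

(** * The volume under linear maps *)

Section Volume.
Set Implicit Arguments.
Unset Strict Implicit.
Variables (R : realType) (d : nat).
Implicit Types (a b w x z : 'rV[R]_d) (S : set 'rV[R]_d).

Lemma box_vol_ge0 a b : (forall i, a 0 i <= b 0 i) -> 0 <= box_vol a b.
Proof. by move=> ab; apply: prodr_ge0 => i _; rewrite subr_ge0. Qed.

Lemma vol_le_cover S (a b : nat -> 'rV[R]_d) :
  (forall n i, a n 0 i <= b n 0 i) -> S `<=` \bigcup_n box (a n) (b n) ->
  (vol S <= \sum_(0 <= n <oo) (box_vol (a n) (b n))%:E)%E.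
Proof. by move=> ab Sab; apply: ereal_inf_lbound; exists a, b. Qed.

(** A bijection of [nat] with [nat * nat] turns the double family into one sequence; nonnegative
    terms may be summed in any order. *)
Lemma vol_le_double_cover S (a b : nat -> nat -> 'rV[R]_d) :
  (forall n k i, a n k 0 i <= b n k 0 i) ->
  S `<=` \bigcup_n \bigcup_k box (a n k) (b n k) ->
  (vol S <= \sum_(0 <= n <oo) \sum_(0 <= k <oo)
     (box_vol (a n k) (b n k))%:E)%E.
Proof.
move=> ab Sab; have /card_esym/ppcard_eqP[f] := card_nat2.
pose v (p : nat * nat) := (box_vol (a p.1 p.2) (b p.1 p.2))%:E.
have v0 p : (0 <= v p)%E by rewrite lee_fin box_vol_ge0.
apply: (@le_trans _ _ (\sum_(0 <= n <oo) v (f n))%E).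
  apply: (@vol_le_cover S (fun n => a (f n).1 (f n).2)
    (fun n => b (f n).1 (f n).2)) => // x /Sab[n _ [k _ xnk]].
  by exists (f^-1%FUN (n, k)) => //=; rewrite invK ?inE.
rewrite nneseries_esumT//.
rewrite -(reindex_esum setT setT f v)//.
rewrite nneseries_esumT; last by move=> n; apply: nneseries_ge0 => k _ _; exact: v0 (n, k).
under [leRHS]eq_esum => n _.
  rewrite nneseries_esumT; last by move=> k; exact: v0 (n, k).
  over.
rewrite (esum_esum (a := fun n k => v (n, k))); last by move=> n k *; exact: v0 (n, k).
rewrite (_ : setT `*`` (fun=> setT) = setT)//.
by apply/seteqP; split => //.
Qed.

(** Reduces a volume bound to single boxes: the image of box [n] of a cover is covered with excess
    at most [e / 2 ^ (n + 1)], and these errors sum to [e]. *)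
Lemma vol_image_le (f : 'rV[R]_d -> 'rV[R]_d) (c : R) S : 0 < c ->
  (forall a b e, (forall i, a 0 i <= b 0 i) -> 0 < e ->
    exists a' b' : nat -> 'rV[R]_d, [/\ forall n i, a' n 0 i <= b' n 0 i,
      f @` box a b `<=` \bigcup_n box (a' n) (b' n) &
      (\sum_(0 <= n <oo) (box_vol (a' n) (b' n))%:E <=
       (c * box_vol a b + e)%:E)%E]) ->
  (vol (f @` S) <= c%:E * vol S)%E.
Proof.
move=> c0 fbox; rewrite -lee_pdivrMl//; apply: le_ereal_inf_tmp => _ [a [b [ab [Sab ->]]]].
rewrite lee_pdivrMl//; apply/lee_addgt0Pr => e e0.
have /choice[g Pg] : forall n, exists g : (nat -> 'rV[R]_d) * (nat -> 'rV[R]_d),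
    [/\ forall n i, g.1 n 0 i <= g.2 n 0 i,
      f @` box (a n) (b n) `<=` \bigcup_n box (g.1 n) (g.2 n) &
      (\sum_(0 <= n <oo) (box_vol (g.1 n) (g.2 n))%:E <=
       (c * box_vol (a n) (b n) + e / (2 ^ n.+1)%:R)%:E)%E].
  move=> n; have [|a' [b' H]] := fbox _ _ (e / (2 ^ n.+1)%:R) (ab n).
    by rewrite divr_gt0.
  by exists (a', b').
apply: le_trans (@vol_le_double_cover (f @` S) (fun n => (g n).1)
  (fun n => (g n).2) _ _) _.
- by move=> n k i; have [] := Pg n.
- move=> _ [x /Sab[n _ xn] <-]; exists n => //.
  by have [_ + _] := Pg n; apply; exists x.
rewrite -nneseriesZl//; last by move=> n _; rewrite lee_fin box_vol_ge0.
apply: le_trans (epsilon_trick _ _ (ltW e0)); last first.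
  by move=> n; rewrite -EFinM lee_fin mulr_ge0 ?(ltW c0) ?box_vol_ge0.
apply: lee_nneseries => n _.
  by move=> _; apply: nneseries_ge0 => k _ _; rewrite lee_fin box_vol_ge0//; have [] := Pg n.
by have [_ _] := Pg n; rewrite EFinD EFinM.
Qed.

Lemma vol_le S T : S `<=` T -> (vol S <= vol T)%E.
Proof.
move=> ST; apply: le_ereal_inf_tmp => _ [a [b [ab [Tab ->]]]].
by apply: vol_le_cover => // x /ST /Tab.
Qed.

(** The index [k] rules out dimension [0], where the empty product is [1]. Degenerate boxes pad
    finite covers to sequences. *)
Lemma box_vol_refl (k : 'I_d) a : box_vol a a = 0.
Proof. by rewrite /box_vol (bigD1 k)//= subrr mul0r. Qed.

Lemma series_truncate N (u : nat -> R) :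
  (\sum_(0 <= n <oo) (if (n < N)%N then u n else 0)%:E)%E =
  (\sum_(n < N) u n)%:E.
Proof.
apply/cvg_lim => //; apply: cvg_near_cst; near=> n.
have Nn : (N <= n)%N by near: n; exact: nbhs_infty_ge.
rewrite sumEFin; congr (_%:E).
rewrite (big_cat_nat (leq0n N) Nn)//= [X in _ + X]big_nat_cond [X in _ + X]big1 ?addr0.
  by rewrite big_mkord; apply: eq_bigr => i _; rewrite ltn_ord.
by move=> i /andP[/andP[Ni _] _]; rewrite ltnNge Ni.
Unshelve. all: by end_near. Qed.

(** * Volume under single-row changes and their products *)

Definition setrow (k : 'I_d) (w : 'rV[R]_d) : 'M[R]_d :=
  \matrix_(i, j) if i == k then w 0 j else (i == j)%:R.

Lemma mulmx_setrowE x k w j :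
  (x *m setrow k w) 0 j = (if j == k then 0 else x 0 j) + x 0 k * w 0 j.
Proof.
rewrite mxE (bigD1 k)//= !mxE eqxx addrC; congr (_ + _).
have [->|jk] := eqVneq j k.
  by rewrite big1// => i ik; rewrite mxE (negPf ik) mulr0.
rewrite (bigD1 j)//= mxE (negPf jk) eqxx mulr1 big1 ?addr0// => i /andP[ik ij].
by rewrite mxE (negPf ik) (negPf ij) mulr0.
Qed.

(** Expansion along row [k]: the cofactors do not see that row, so they are those of the
    identity. *)
Lemma det_setrow k w : \det (setrow k w) = w 0 k.
Proof.
have adj1 : \adj (1%:M : 'M[R]_d) = 1%:M.
  by rewrite -[LHS]mul1mx mul_mx_adj det1.
rewrite (expand_det_row _ k) (bigD1 k)//= big1 ?addr0.
  rewrite mxE eqxx (_ : cofactor _ _ _ = (\adj (1%:M : 'M[R]_d)) k k).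
    by rewrite adj1 mxE eqxx mulr1.
  rewrite mxE /cofactor; congr (_ * \det _); apply/matrixP => i j.
  by rewrite !mxE eq_sym (negPf (neq_lift _ _)).
move=> j jk; rewrite (_ : cofactor _ _ _ = (\adj (1%:M : 'M[R]_d)) j k).
  by rewrite adj1 [X in _ * X]mxE (negPf jk) mulr0.
rewrite mxE /cofactor; congr (_ * \det _); apply/matrixP => i l.
by rewrite !mxE eq_sym (negPf (neq_lift _ _)).
Qed.

Lemma itv_slice (y c h : R) N : c <= y <= c + N.+1%:R * h ->
  exists2 l, (l < N.+1)%N & c + l%:R * h <= y <= c + l%:R * h + h.
Proof.
elim: N => [|N IH].
  by rewrite mul1r => H; exists 0%N => //; rewrite mul0r addr0.
have [yle /andP[cy _]|yge /andP[_ yle]] := leP y (c + N.+1%:R * h).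
  by have [|l lN H] := IH; [rewrite cy yle|exists l => //; rewrite ltnS ltnW].
exists N.+1 => //; rewrite (ltW yge) (le_trans yle)//.
by rewrite -[N.+2%:R]natr1 mulrDl mul1r addrA.
Qed.

(* The box is cut into thin slices along the coordinate [k] that feeds the
   others; as the slices get thinner the boxes enclosing their images lose
   the excess volume. *)
Lemma vol_setrow_le k w S : w 0 k != 0 ->
  (vol ((mulmx^~ (setrow k w)) @` S) <= `|w 0 k|%:E * vol S)%E.
Proof.
move=> wk0; apply: vol_image_le; first by rewrite normr_gt0.
move=> a b e ab e0.
pose c i := b 0 i - a 0 i; have c0 i : 0 <= c i by rewrite subr_ge0.
(* The value of [q] at [1 / (N + 1)] is the total volume of the boxes enclosing the images of
   [N + 1] slices; at [0] it is the desired volume, so continuity provides [N]. *)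
pose q := (`|w 0 k| * c k)%:P *
  \prod_(i | i != k) ((c i)%:P + (2 * `|w 0 i| * c k)%:P * 'X).
have q0 : q.[0] = `|w 0 k| * box_vol a b.
  rewrite hornerM hornerC horner_prod /box_vol [in RHS](bigD1 k)//= mulrA.
  by congr (_ * _); apply: eq_bigr => i _; rewrite !hornerE.
have [N qN] : exists N, q.[N.+1%:R^-1] <= q.[0] + e.
  have : (q.[x.+1%:R^-1] @[x --> \oo] --> q.[0])%classic.
    apply: (@cvg_comp _ _ _ (fun n : nat => n.+1%:R^-1) (horner q) _ (nbhs (0:R))).
      exact: cvg_harmonic.
    exact: continuous_horner.
  move/cvgrPdist_le => /(_ _ e0)[N _ /(_ N (leqnn _))] /= H.
  by exists N; rewrite -lerBlDl (le_trans (ler_norm _))// distrC.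
pose h := c k / N.+1%:R; have h0 : 0 <= h by rewrite divr_ge0.
pose s l := a 0 k + l%:R * h.
(* [lo l] and [hi l] are the corners of a box around the image of slice [l]; the minimum and maximum
   cover both signs of [w 0 k]. *)
pose lo l : 'rV[R]_d := \row_i if i == k then Num.min (w 0 k * s l) (w 0 k * (s l + h))
  else a 0 i + w 0 i * s l - `|w 0 i| * h.
pose hi l : 'rV[R]_d := \row_i if i == k then Num.max (w 0 k * s l) (w 0 k * (s l + h))
  else b 0 i + w 0 i * s l + `|w 0 i| * h.
have lohik l : hi l 0 k - lo l 0 k = `|w 0 k| * h.
  rewrite !mxE eqxx; have [wk|wk] := leP 0 (w 0 k).
    have le1 : w 0 k * s l <= w 0 k * (s l + h) by rewrite ler_wpM2l// lerDl.
    by rewrite (min_idPl le1) (max_idPr le1) ger0_norm//; ring.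
  have le1 : w 0 k * (s l + h) <= w 0 k * s l by rewrite ler_wnM2l ?(ltW wk)// lerDl.
  by rewrite (min_idPr le1) (max_idPl le1) ltr0_norm//; ring.
have lohi l i : i != k -> hi l 0 i - lo l 0 i = c i + 2 * `|w 0 i| * h.
  by move=> ik; rewrite !mxE (negPf ik) /c; ring.
have volE l : box_vol (lo l) (hi l) = q.[N.+1%:R^-1] / N.+1%:R.
  rewrite /box_vol (bigD1 k)//= lohik /q hornerM hornerC horner_prod.
  rewrite (_ : \prod_(i | i != k) (hi l 0 i - lo l 0 i) = \prod_(i | i != k)
    ((c i)%:P + (2 * `|w 0 i| * c k)%:P * 'X).[N.+1%:R^-1]).
    by rewrite /h mulrA mulrAC.
  by apply: eq_bigr => i ik; rewrite lohi// /h !hornerE.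
exists (fun l => if (l < N.+1)%N then lo l else 0).
exists (fun l => if (l < N.+1)%N then hi l else 0); split.
- move=> l i; case: ifP => // _; rewrite -subr_ge0.
  have [->|ik] := eqVneq i k; first by rewrite lohik mulr_ge0.
  by rewrite lohi// addr_ge0// !mulr_ge0.
- move=> _ [x xab <-].
  have [|l lN /andP[sx xs]] := @itv_slice (x 0 k) (a 0 k) h N.
    rewrite /h mulrC divfK ?pnatr_eq0// /c subrKC.
    exact: xab.
  exists l => //; rewrite lN => i; rewrite mulmx_setrowE !mxE.
  have [->|ik] := eqVneq i k.
    rewrite add0r [x 0 k * _]mulrC ge_min le_max.
    rewrite -/(s l) in sx xs; have [wk|wk] := leP 0 (w 0 k).
      by rewrite (ler_wpM2l wk sx) (ler_wpM2l wk xs) orbT.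
    by rewrite (ler_wnM2l (ltW wk) sx) (ler_wnM2l (ltW wk) xs) orbT.
  have : `|w 0 i * (x 0 k - s l)| <= `|w 0 i| * h.
    rewrite normrM ler_wpM2l// ger0_norm ?subr_ge0//.
    by rewrite lerBlDl.
  rewrite ler_norml => /andP[].
  have /andP[] := xab i.
  by move=> *; apply/andP; split; lra.
under eq_eseriesr => l _.
  rewrite (_ : box_vol _ _ = if (l < N.+1)%N then box_vol (lo l) (hi l) else 0);
    last by case: ifP => // _; rewrite (box_vol_refl k).
  over.
rewrite series_truncate lee_fin.
under eq_bigr => l _ do rewrite volE.
by rewrite sumr_const card_ord -(mulr_natr (_ / _)) divfK ?pnatr_eq0// -q0.
Qed.

(** The inverse is again a [setrow], with diagonal entry [1 / w 0 k]; the upper volume bound applied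
    to it gives the matching lower bound. *)
Lemma setrowK k w : w 0 k != 0 -> cancel (mulmx^~ (setrow k w))
  (fun x => x *m setrow k (\row_j if j == k then (w 0 k)^-1 else - w 0 j / w 0 k)).
Proof.
move=> wk0 x; apply/rowP => j; rewrite mulmx_setrowE !mulmx_setrowE mxE eqxx add0r.
have [->|jk] := eqVneq j k; first by rewrite add0r mulfK.
by field.
Qed.

Lemma vol_setrow k w S : w 0 k != 0 ->
  vol ((mulmx^~ (setrow k w)) @` S) = (`|w 0 k|%:E * vol S)%E.
Proof.
move=> wk0; apply/eqP; rewrite eq_le vol_setrow_le//= -lee_pdivlMl ?normr_gt0//.
pose w' := \row_j if j == k then (w 0 k)^-1 else - w 0 j / w 0 k.
have w'k : w' 0 k = (w 0 k)^-1 by rewrite mxE eqxx.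
rewrite -normfV -w'k (le_trans _ (vol_setrow_le _ _)) ?w'k ?invr_neq0//.
rewrite image_comp; apply: vol_le => x Sx; exists x => //=.
by rewrite setrowK.
Qed.

(* For [A] near the identity every [mix_rows A n] is invertible, and consecutive
   ones differ by a factor [setrow]. *)
Definition mix_rows (A : 'M[R]_d) n : 'M[R]_d :=
  \matrix_(i, j) if (i < n)%N then A i j else (i == j)%:R.

(** The rows of [mix_rows A k] form a basis; the new row of [A] is expressed in it. *)
Lemma mix_rowsS A (k : 'I_d) : mix_rows A k \in unitmx ->
  mix_rows A k.+1 = setrow k (row k A *m invmx (mix_rows A k)) *m mix_rows A k.
Proof.
move=> Au; apply/row_matrixP => i; rewrite row_mul.
have [->|ik] := eqVneq i k.
  rewrite (_ : row k (setrow _ _) = row k A *m invmx (mix_rows A k)).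
    by rewrite mulmxKV//; apply/rowP => j; rewrite !mxE ltnSn.
  by apply/rowP => j; rewrite mxE mxE eqxx.
rewrite (_ : row i (setrow _ _) = row i 1%:M).
  rewrite -row_mul mul1mx; apply/rowP => j; rewrite !mxE ltnS leq_eqVlt.
  by rewrite -val_eqE in ik; rewrite (negPf ik).
by apply/rowP => j; rewrite !mxE (negPf ik).
Qed.

Lemma vol_linear A S : (forall n, \det (mix_rows A n) != 0) ->
  vol ((mulmx^~ A) @` S) = (`|\det A|%:E * vol S)%E.
Proof.
move=> dA0.
have unitA n : mix_rows A n \in unitmx by rewrite unitmxE unitfE.
have -> : A = mix_rows A d by apply/matrixP => i j; rewrite mxE ltn_ord.
suff H n : (n <= d)%N -> forall S, vol ((mulmx^~ (mix_rows A n)) @` S) =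
    (`|\det (mix_rows A n)|%:E * vol S)%E by exact: H.
elim: n => [_ {}S|n IH nd {}S].
  have -> : mix_rows A 0 = 1%:M by apply/matrixP => i j; rewrite !mxE.
  rewrite det1 normr1 mul1e; congr vol; apply/seteqP; split => [_ [x Sx <-]|x Sx].
    by rewrite mulmx1.
  by exists x; rewrite ?mulmx1.
pose k := Ordinal nd; have := @mix_rowsS A k (unitA _); set w := (X in setrow k X).
(* The factor [setrow k w] has determinant [w 0 k], which is therefore nonzero. *)
move=> E; move: (dA0 n.+1); rewrite E det_mulmx mulf_eq0 negb_or det_setrow.
move=> /andP[wk0 _]; rewrite normrM EFinM muleAC.
rewrite (_ : image _ _ = (mulmx^~ (mix_rows A n)) @` ((mulmx^~ (setrow k w)) @` S)).
  rewrite IH ?(ltnW nd)// vol_setrow// muleCA muleA [RHS]muleAC.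
  by rewrite muleC muleA.
by rewrite image_comp; apply: eq_imagel => x _ /=; rewrite mulmxA.
Qed.

Lemma vol_translate_le z S : (vol ((+%R^~ z) @` S) <= vol S)%E.
Proof.
apply: le_ereal_inf_tmp => _ [a [b [ab [Sab ->]]]].
apply: le_trans (@vol_le_cover _ (fun n => a n + z) (fun n => b n + z) _ _) _.
- by move=> n i; rewrite !mxE lerD2r.
- move=> _ [x /Sab[n _ xn] <-]; exists n => // i.
  by rewrite !mxE !lerD2r; exact: xn.
rewrite le_eqVlt; apply/orP; left; apply/eqP; apply: eq_eseriesr => n _.
congr (_%:E); apply: eq_bigr => i _; rewrite !mxE; ring.
Qed.

Lemma vol_aff_image A z S : (forall n, \det (mix_rows A n) != 0) ->
  vol (aff_image A z S) = (`|\det A|%:E * vol S)%E.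
Proof.
move=> dA0; rewrite -vol_linear//.
have -> : aff_image A z S = (+%R^~ z) @` ((mulmx^~ A) @` S) by rewrite image_comp.
apply/eqP; rewrite eq_le vol_translate_le/=.
apply: le_trans (vol_translate_le (- z) _); apply: vol_le => _ [x Sx <-].
by rewrite image_comp; exists (x *m A) => //=; [exists x|rewrite addrK].
Qed.

(** * Lower bound for the volume of a box; finiteness and positivity *)

Lemma le_integral_indic_series (c a b : R) (g a' b' : nat -> R) :
  0 <= c -> a <= b -> (forall n, 0 <= g n) -> (forall n, a' n <= b' n) ->
  (forall t, (c * \1_(`[a, b]) t)%:E <=
    \sum_(0 <= n <oo) (g n * \1_(`[a' n, b' n]) t)%:E)%E ->
  ((c * (b - a))%:E <= \sum_(0 <= n <oo) (g n * (b' n - a' n))%:E)%E.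
Proof.
move=> c0 ab g0 ab' H.
have intE (k l u : R) : 0 <= k -> l <= u ->
    (\int[lebesgue_measure]_t (k * \1_(`[l, u]) t)%:E)%E = (k * (u - l))%:E.
  move=> k0 lu; under eq_integral do rewrite EFinM.
  rewrite ge0_integralZl_EFin//; last by apply/measurable_EFinP; exact: measurable_indic.
  rewrite integral_indic// setIT/= lebesgue_measure_itv/= lte_fin.
  have [//|ul] := ltP l u.
  by have -> : u = l by [apply/eqP; rewrite eq_le ul lu]; rewrite subrr mulr0 mule0.
have meas (k l u : R) : measurable_fun setT (fun t => (k * \1_(`[l, u]) t)%:E).
  by apply/measurable_EFinP/measurable_funM => //; exact: measurable_indic.
have ge0 (n : nat) t : (0 <= (g n * \1_(`[a' n, b' n]) t)%:E)%E.
  by rewrite lee_fin mulr_ge0.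
rewrite -intE//; apply: (@le_trans _ _ (\int[lebesgue_measure]_t
    \sum_(0 <= n <oo) (g n * \1_(`[a' n, b' n]) t)%:E)%E).
  apply: ge0_le_integral => //; [by move=> t _; rewrite lee_fin mulr_ge0|exact: meas|].
  exact: (@ge0_emeasurable_sum _ _ _ _ (fun n t => (g n * \1_(`[a' n, b' n]) t)%:E)
    predT (fun n t _ _ => ge0 n t) (fun n _ => meas _ _ _)).
rewrite integral_nneseries//; last by move=> n; exact: meas.
by rewrite le_eqVlt; apply/orP; left; apply/eqP/eq_eseriesr => n _; rewrite intE.
Qed.

(* Integrating a covering inequality between indicator functions over one
   coordinate at a time turns each indicator factor into a side length. *)
Lemma vol_box_ge a b : (forall i, a 0 i <= b 0 i) ->
  ((box_vol a b)%:E <= vol (box a b))%E.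
Proof.
move=> ab; apply: le_ereal_inf_tmp => _ [a' [b' [ab' [Sab ->]]]].
(* Coordinates below [k] are already integrated and contribute side lengths; the others are still
   indicators. The case [k = 0] is the covering property, [k = d] the volume inequality. *)
pose f k (u v x : 'rV[R]_d) (i : 'I_d) : R :=
  if (i < k)%N then v 0 i - u 0 i else \1_(`[u 0 i, v 0 i]) (x 0 i).
have f0 k (u v x : 'rV[R]_d) i : (forall i, u 0 i <= v 0 i) -> 0 <= f k u v x i.
  by move=> uv; rewrite /f; case: ifP => _; rewrite ?subr_ge0.
suff H k : (k <= d)%N -> forall x, ((\prod_i f k a b x i)%:E <=
    \sum_(0 <= n <oo) (\prod_i f k (a' n) (b' n) x i)%:E)%E.
  have := H d (leqnn d) 0; rewrite /box_vol /f.
  under eq_bigr do rewrite ltn_ord.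
  move=> /le_trans; apply; rewrite le_eqVlt; apply/orP; left; apply/eqP.
  by apply: eq_eseriesr => n _; congr (_%:E); apply: eq_bigr => i _; rewrite ltn_ord.
elim: k => [_ x|k IH kd x].
  have ser0 : (0 <= \sum_(0 <= n <oo) (\prod_i f 0%N (a' n) (b' n) x i)%:E)%E.
    by apply: nneseries_ge0 => n _ _; rewrite lee_fin prodr_ge0.
  have [xab|/existsNP[i xi]] := pselect (box a b x); last first.
    rewrite (bigD1 i)//= {1}/f/= indicE memNset ?mul0r//= in_itv.
  rewrite big1; last first.
    by move=> i _; rewrite /f/= indicE mem_set//= in_itv/=; exact: xab.
  have [n _ xn] := Sab _ xab.
  rewrite (@nneseriesD1 _ _ n)//; last by move=> m _; rewrite lee_fin prodr_ge0.
  rewrite big1; last first.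
    by move=> i _; rewrite /f/= indicE mem_set//= in_itv/=; exact: xn.
  by rewrite leeDl// nneseries_ge0// => m _ _; rewrite lee_fin prodr_ge0.
pose kk := Ordinal kd.
(* Coordinate [k] becomes the integration variable; the other factors are constant in [t]. *)
pose y t : 'rV[R]_d := \row_i if i == kk then t else x 0 i.
have fE (u v : 'rV[R]_d) t : \prod_i f k u v (y t) i =
    (\prod_(i | i != kk) f k.+1 u v x i) * \1_(`[u 0 kk, v 0 kk]) t.
  rewrite (bigD1 kk)//= mulrC; congr (_ * _); last first.
    by rewrite /f ltnn mxE eqxx.
  apply: eq_bigr => i ik; rewrite /f mxE (negPf ik) ltnS [in RHS]leq_eqVlt.
  by rewrite -val_eqE/= in ik; rewrite (negPf ik).
have fE' (u v : 'rV[R]_d) : \prod_i f k.+1 u v x i =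
    (\prod_(i | i != kk) f k.+1 u v x i) * (v 0 kk - u 0 kk).
  by rewrite (bigD1 kk)//= mulrC {2}/f ltnSn.
rewrite fE'; under eq_eseriesr do rewrite fE'.
apply: le_integral_indic_series => //.
- by apply: prodr_ge0 => i _; exact: f0.
- by move=> n; apply: prodr_ge0 => i _; exact: f0.
- move=> t; have := IH (ltnW kd) (y t).
  by rewrite fE; under eq_eseriesr do rewrite fE.
Qed.

Lemma vol_box_le (k : 'I_d) a b : (forall i, a 0 i <= b 0 i) ->
  (vol (box a b) <= (box_vol a b)%:E)%E.
Proof.
move=> ab; apply: le_trans (@vol_le_cover _ (fun n => if (n < 1)%N then a else 0)
  (fun n => if (n < 1)%N then b else 0) _ _) _.
- by move=> n i; case: ifP.
- by move=> x xab; exists 0%N.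
under eq_eseriesr => n _.
  rewrite (_ : box_vol _ _ = if (n < 1)%N then box_vol a b else 0);
    last by case: ifP => // _; rewrite (box_vol_refl k).
  over.
by rewrite (series_truncate 1 (fun=> box_vol a b)) big_ord1.
Qed.

(** Finiteness, together with positivity, makes a determinant above [1] increase the volume of [K]
    strictly. *)
Lemma vol_compact_lty (k : 'I_d) S : compact S -> (vol S < +oo)%E.
Proof.
move=> /compact_bounded[N [_ /(_ (N + 1))]]; rewrite ltrDl => /(_ ltr01) SM.
pose M := N + 1; have M0 : 0 <= `|M| by [].
apply: (@le_lt_trans _ _ (vol (box (const_mx (- `|M|)) (const_mx `|M|)))).
  apply: vol_le => x Sx i; rewrite !mxE -ler_norml (le_trans (normr_coord _ _))//.
  by rewrite (le_trans (SM _ Sx))// ler_norm.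
by apply: le_lt_trans (vol_box_le k _) (ltry _) => i; rewrite !mxE; lra.
Qed.

Lemma vol_interior_gt0 S : S° 0 -> (0 < vol S)%E.
Proof.
move=> /interior0_cube[r r0 rS].
apply: (@lt_le_trans _ _ (vol (box (const_mx (- r)) (const_mx r)))); last first.
  apply: vol_le => x xr; apply: rS => i.
  by have := xr i; rewrite !mxE ler_norml.
apply: lt_le_trans (vol_box_ge _) => [|i]; last by rewrite !mxE; lra.
by rewrite lte_fin; apply: prodr_gt0 => i _; rewrite !mxE; lra.
Qed.

End Volume.

(** * Perturbing the identity *)

Section Perturbation.
Set Implicit Arguments.
Unset Strict Implicit.
Variables (R : realType) (d : nat).
Implicit Types (x p z : 'rV[R]_d) (K L : set 'rV[R]_d) (H : 'M[R]_d).

Lemma nbhs0_pos (P : R -> Prop) : (\forall t \near (0 : R), P t) ->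
  exists2 t0 : R, 0 < t0 & forall t, 0 < t <= t0 -> P t.
Proof.
move=> /nbhs_ballP[e /= e0 eP]; exists (e / 2); first by rewrite divr_gt0.
move=> t /andP[t0 te]; apply: eP; rewrite /ball/= sub0r normrN gtr0_norm//.
by apply: le_lt_trans te _; rewrite ltr_pdivrMr// ltr_pMr// ltr1n.
Qed.

(** Each determinant is a polynomial in [t] with value [1] at [0], and only the finitely many
    [m <= d] give different matrices. *)
Lemma det_mix_rows_neq0 H : exists2 t0 : R, 0 < t0 &
  forall t, 0 < t <= t0 -> forall m, \det (mix_rows (1%:M - t *: H) m) != 0.
Proof.
pose Q m : 'M[{poly R}]_d := \matrix_(i, j)
  if (i < m)%N then (i == j)%:R - 'X * (H i j)%:P else (i == j)%:R.
have QE m t : (\det (Q m)).[t] = \det (mix_rows (1%:M - t *: H) m).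
  rewrite -horner_evalE -det_map_mx; congr (\det _); apply/matrixP => i j.
  by rewrite !mxE; case: ifP => _; case: eqP => _; rewrite /= ?horner_evalE !hornerE.
have Q0 m : (\det (Q m)).[0] = 1.
  rewrite QE scale0r subr0 -[RHS](det1 R d); congr (\det _); apply/matrixP => i j.
  by rewrite !mxE; case: ifP.
have near0 : \forall t \near (0 : R), forall m : 'I_d.+1, (\det (Q m)).[t] != 0.
  apply: (@filter_forall R 'I_d.+1 (fun m t => (\det (Q m)).[t] != 0)
    (nbhs (0 : R)) (nbhs_filter _)) => m.
  have := @continuous_horner R (\det (Q m)) 0.
  rewrite /continuous_at Q0 => /cvgr_neq0; apply; exact: oner_neq0.
have [t0 t00 t0P] := nbhs0_pos near0; exists t0 => // t tt0 m.
have [md|dm] := leqP m d.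
  by rewrite -QE; exact: (t0P t tt0 (Ordinal (md : (m < d.+1)%N))).
rewrite (_ : mix_rows _ m = mix_rows (1%:M - t *: H) d).
  by rewrite -QE; exact: (t0P t tt0 ord_max).
by apply/matrixP => i j; rewrite !mxE ltn_ord (ltn_trans (ltn_ord i)).
Qed.

(** With [chi] the characteristic polynomial of [H], the determinant is [t ^ d * chi(1 / t)], and
    [chi - X ^ d] has leading coefficient [- tr H > 0], so it is positive at large [1 / t]. *)
Lemma det_perturb_gt1 (k : 'I_d) H : \tr H < 0 -> exists2 t0 : R, 0 < t0 &
  forall t, 0 < t <= t0 -> 1 < \det (1%:M - t *: H).
Proof.
move=> trH; have d0 : (0 < d)%N := leq_ltn_trans (leq0n k) (ltn_ord k).
pose r := char_poly H - 'X^d.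
have rd : r`_d.-1 = - \tr H.
  by rewrite coefB char_poly_trace// coefXn ltn_eqF ?prednK ?subr0.
have size_r : size r = d.
  apply/eqP; rewrite eqn_leq; apply/andP; split.
    apply/leq_sizeP => j; rewrite leq_eqVlt => /predU1P[<-|dj].
      rewrite coefB coefXn eqxx.
      have /monicP := char_poly_monic H; rewrite /lead_coef size_char_poly/= => ->.
      by rewrite subrr.
    by rewrite coefB coefXn (gtn_eqF dj) subr0 nth_default// size_char_poly.
  rewrite -(prednK d0) ltnNge; apply/negP => /leq_sizeP/(_ _ (leqnn _)).
  by rewrite rd => /eqP; rewrite oppr_eq0 (lt_eqF trH).
have lr : 0 < lead_coef r by rewrite /lead_coef size_r rd oppr_gt0.
have [s0 s0P] := polyrcf.poly_pinfty_gt_lc lr.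
have M0 : 0 < 1 + `|s0| by rewrite ltr_pwDl.
exists (1 + `|s0|)^-1; first by rewrite invr_gt0.
move=> t /andP[t0 tt0].
have s0t : s0 <= t^-1.
  rewrite (le_trans (ler_norm _))// (@le_trans _ _ (1 + `|s0|)) ?lerDr//.
  by rewrite -[leLHS]invrK lef_pV2// posrE invr_gt0.
have := lt_le_trans lr (s0P _ s0t).
rewrite hornerD hornerN hornerXn subr_gt0 => charlt.
have -> : 1%:M - t *: H = t *: (t^-1%:M - H).
  by rewrite scalerBr scale_scalar_mx divff// gt_eqF.
rewrite detZ (_ : \det _ = (char_poly H).[t^-1]).
  rewrite -(@ltr_pM2l _ (t ^+ d)) ?exprn_gt0// in charlt.
  by rewrite -exprMn divff ?gt_eqF// expr1n in charlt.
rewrite /char_poly -horner_evalE -det_map_mx; congr (\det _); apply/matrixP => i j.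
by rewrite !mxE; case: eqP => _; rewrite /= ?horner_evalE !hornerE.
Qed.

Lemma perturb_subset K L H z : compact K -> compact L -> is_convex L -> L° 0 ->
  K `<=` L ->
  (forall x p, K x -> polar L p -> dotv p x = 1 -> 0 < dotv p (x *m H + z)) ->
  exists2 t0 : R, 0 < t0 &
    forall t, 0 < t <= t0 -> forall x, K x -> L (x - t *: (x *m H + z)).
Proof.
move=> cK cL xL L0 KL gpos.
pose f (xp : 'rV[R]_d * 'rV[R]_d) := dotv xp.2 xp.1.
pose g (xp : 'rV[R]_d * 'rV[R]_d) := dotv xp.2 (xp.1 *m H + z).
have c1 : continuous (fun xp : 'rV[R]_d * 'rV[R]_d => xp.1).
  by move=> xp; exact: cvg_fst.
have c2 : continuous (fun xp : 'rV[R]_d * 'rV[R]_d => xp.2).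
  by move=> xp; exact: cvg_snd.
have cf : continuous f by exact: continuous_dotv.
have cg : continuous g.
  apply: continuous_dotv => // xp; apply: cvgD; last exact: cvg_cst.
  exact: continuous_mulmx.
have f1 x p : K x -> polar L p -> f (x, p) <= 1.
  by move=> Kx Lp; rewrite /f dotvC; exact/Lp/KL.
suff [t0 t00 fg] : exists2 t0 : R, 0 < t0 & forall t, 0 < t <= t0 ->
    forall x p, K x -> polar L p -> f (x, p) - t * g (x, p) <= 1.
  exists t0 => // t tt0 x Kx; apply: contrapT => nL.
  have [p Lp] := bipolar_separation cL xL L0 nL.
  by rewrite dotvBr dotvZr ltNge (fg t tt0 x p Kx Lp).
(* Only pairs in [B] can violate the inequality. By compactness [f] has a maximum on [B], below [1]
   since [g > 0] wherever [f = 1]. *)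
pose B := (K `*` polar L) `&` (g @^-1` [set u | u <= 0]).
have cB : compact B.
  apply: compact_closedI; first exact: compact_setX cK (compact_polar L0).
  by apply: closed_comp; [move=> xp _; exact: cg|exact: closed_le].
have offB t x p : 0 < t -> K x -> polar L p -> ~ B (x, p) ->
    f (x, p) - t * g (x, p) <= 1.
  move=> t0 Kx Lp nB; rewrite (le_trans _ (f1 _ _ Kx Lp))// gerBl mulr_ge0 ?ltW//.
  by rewrite ltNge; apply/negP => gle; apply: nB.
have [/nonemptyPn B0|B0] := pselect (~ (B !=set0)).
  by exists 1 => // t /andP[t0 _] x p Kx Lp; apply: offB => //; rewrite B0.
have {}B0 : B !=set0 by apply: contrapT.
have [c cB' cmax] := compact_EVT_max B0 cB (continuous_subspaceT cf).
have [e _ emin] := compact_EVT_min B0 cB (continuous_subspaceT cg).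
have fc1 : f c < 1.
  move: cB'; rewrite inE => -[[Kc Lc] gc]; rewrite lt_neqAle f1 ?andbT; last by [].
    apply/eqP => fc; move: gc; rewrite /= leNgt gpos//.
  by case: (c) Kc Lc.
have M0 : 0 < 1 + `|g e| by rewrite ltr_pwDl.
(* On [B] the term [- t * g] is at most [t] times the absolute value of the minimum [g e], which
   fits into the gap [1 - f c]. *)
exists ((1 - f c) / (1 + `|g e|)); first by rewrite divr_gt0// subr_gt0.
move=> t /andP[t0 tt0] x p Kx Lp.
have [/mem_set Bxp|] := pselect (B (x, p)); last exact: offB.
have := cmax _ Bxp; have := emin _ Bxp; move: tt0; rewrite ler_pdivlMr//.
set F := f (x, p); set G := g (x, p) => tt0 eG Fc.
have : - g e <= `|g e| by rewrite -normrN ler_norm.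
by move=> ?; nra.
Qed.

End Perturbation.

(** * Contact pairs *)

Section OrthogonalProjection.
Set Implicit Arguments.
Unset Strict Implicit.
Variables (R : realType) (d : nat) (F P : 'M[R]_d).
Hypothesis projP : orth_proj F P.
Implicit Types (x y : 'rV[R]_d).

Lemma orth_proj_perp x : in_perp F x -> x *m P = 0.
Proof.
move=> xF; have [xPF xxP] := projP x; apply/eqP; rewrite -dotv_eq0.
by rewrite -[X in dotv X _](subKr x) dotvBl xF// xxP// subrr.
Qed.

Lemma orth_proj_tr : P^T = P.
Proof.
have selfadj x y : dotv (x *m P) y = dotv x (y *m P).
  (* The right-hand side is symmetric in [u] and [v], which yields self-adjointness. *)
  have half u v : dotv (u *m P) v = dotv (u *m P) (v *m P).
    rewrite -{1}[v](subrK (v *m P)) dotvDr dotvC (projP v).2 ?add0r//.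
    exact: (projP u).1.
  by rewrite half [RHS]dotvC [RHS]half dotvC.
apply/matrixP => i j; rewrite mxE.
have E k l : P k l = dotv (delta_mx 0 k *m P) (delta_mx 0 l).
  rewrite -rowE /dotv (bigD1 l)//= big1 ?addr0 => [|m ml].
    by rewrite !mxE !eqxx mulr1.
  by rewrite !mxE (negPf ml) andbF mulr0.
by rewrite E selfadj dotvC -E.
Qed.

Lemma orth_proj_idem : P *m P = P.
Proof.
apply/row_matrixP => i; rewrite row_mul rowE.
have /eqP := orth_proj_perp (projP (delta_mx 0 i)).2.
by rewrite mulmxBl subr_eq0 => /eqP <-.
Qed.

(** The operator is [(1 + t c) - t P H P]; as [P] kills the orthogonal complement of [F], it acts
    there as the scalar [1 + t c]. *)
Lemma F_operator_perturb (H : 'M[R]_d) (c t : R) :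
  1%:M - t *: (P *m H *m P - c%:M) \in unitmx -> 1 + t * c != 0 ->
  F_operator F (1%:M - t *: (P *m H *m P - c%:M)).
Proof.
move=> uA tc; set A := 1%:M - _.
have AE x : x *m A = (1 + t * c) *: x - t *: (x *m P *m H *m P).
  rewrite /A mulmxBr mulmx1 -scalemxAr mulmxBr mul_mx_scalar !mulmxA.
  by rewrite scalerBr scalerDl scale1r scalerA opprB addrA addrAC.
have perpA x : in_perp F x -> x *m A = (1 + t * c) *: x.
  by move=> xF; rewrite AE (orth_proj_perp xF) !mul0mx scaler0 subr0.
split=> //; split; [|split].
- move=> x xF; rewrite /in_sub AE addmx_sub ?eqmx_opp ?scalemx_sub//.
  exact: (projP _).1.
- by move=> x xF y yF; rewrite perpA// dotvZl xF// mulr0.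
- by exists (1 + t * c).
Qed.

End OrthogonalProjection.

(** * Contact pairs and the consequence of maximal volume *)

Section ContactPairs.
Set Implicit Arguments.
Unset Strict Implicit.
Variables (R : realType) (d : nat) (K L : set 'rV[R]_d).
Hypotheses (bK : convex_body K) (bL : convex_body L).
Hypotheses (K0 : K° 0) (L0 : L° 0) (KL : K `<=` L).

(** A description of contact pairs by closed conditions, from which compactness is immediate. *)
Definition touching : set ('rV[R]_d * 'rV[R]_d) :=
  (K `*` polar L) `&` [set xp | dotv xp.2 xp.1 = 1].

(** The functional [p] supports [K] and [L] at [x], and dually [x] supports both polars at [p]. *)
Lemma contact_pair_touching x p : touching (x, p) -> contact_pair K L x p.
Proof.
move=> [[/= Kx Lp] px1]; have Kp : polar K p by move=> y /KL; exact: Lp.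
split; first by apply: (@bd_of_supporting _ _ K p) => // y /Kp; rewrite dotvC.
split; first by apply: (@bd_of_supporting _ _ L p) => // [y /Lp|]; [rewrite dotvC|exact: KL].
split; first by apply: (@bd_of_supporting _ _ _ x) => // [y Ky|]; [exact: Ky|rewrite dotvC].
split=> //; apply: (@bd_of_supporting _ _ _ x) => // [y Ly|]; last by rewrite dotvC.
exact/Ly/KL.
Qed.

Lemma compact_touching : compact touching.
Proof.
have [cK _] := bK; apply: compact_closedI; first exact: compact_setX cK (compact_polar L0).
apply: (@closed_comp _ _ (fun xp : 'rV[R]_d * 'rV[R]_d => dotv xp.2 xp.1) [set 1]).
  move=> xp _; apply: continuous_dotv => {}xp; [exact: cvg_snd|exact: cvg_fst].
exact: closed_eq.
Qed.

Variables (F P : 'M[R]_d) (k : 'I_d).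
Hypothesis projP : orth_proj F P.
Hypothesis maxK : forall K', A_F F K K' -> K' `<=` L -> (vol K' <= vol K)%E.

(** The support condition required by [hull_of_support]: a direction [(H, z)] violating it would
    move [K] to a larger image inside [L]. *)
Lemma touching_below (H : 'M[R]_d) z : exists2 xp, touching xp &
  dotv xp.2 (xp.1 *m (P *m H *m P)) + dotv xp.2 z <= \tr (P *m H *m P) / d%:R.
Proof.
have d0 : 0 < d%:R :> R by rewrite ltr0n (leq_ltn_trans _ (ltn_ord k)).
have [cK _] := bK; have [cL [xL _]] := bL.
set G := P *m H *m P; set tau := _ / _.
apply: contrapT => noxp.
pose g (xp : 'rV[R]_d * 'rV[R]_d) := dotv xp.2 (xp.1 *m G) + dotv xp.2 z.
have gtau xp : touching xp -> tau < g xp.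
  by move=> txp; rewrite ltNge; apply/negP => gle; apply: noxp; exists xp.
have cg : continuous g.
  have c1 : continuous (fun xp : 'rV[R]_d * 'rV[R]_d => xp.1).
    by move=> xp; exact: cvg_fst.
  have c2 : continuous (fun xp : 'rV[R]_d * 'rV[R]_d => xp.2).
    by move=> xp; exact: cvg_snd.
  move=> xp; apply: cvgD; apply: continuous_dotv => //.
    exact: continuous_mulmx.
  exact: cst_continuous.
(* Compactness makes the strict inequality uniform. *)
have [e e0 etau] : exists2 e : R, 0 < e & forall xp, touching xp -> tau + e <= g xp.
  have [T0|T0] := pselect (touching !=set0); last first.
    by exists 1 => // xp txp; case: T0; exists xp.
  have [xp /set_mem txp xpmin] :=
    compact_EVT_min T0 compact_touching (continuous_subspaceT cg).
  exists (g xp - tau); first by rewrite subr_gt0 gtau.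
  by move=> yp /mem_set/xpmin; rewrite subrKC.
(* Half of the margin goes to each side: [tr H' = - d e / 2], and [<p, x H' + z> >= e / 2] on
   touching pairs. *)
pose c := tau + e / 2.
pose H' := G - c%:M.
have trH' : \tr H' < 0.
  rewrite raddfB/= mxtrace_scalar /c mulrnDl -(mulr_natr tau) divfK ?gt_eqF//.
  by rewrite opprD addNKr oppr_lt0 pmulrn_lgt0 ?divr_gt0// (leq_ltn_trans _ (ltn_ord k)).
have posH' x p : K x -> polar L p -> dotv p x = 1 -> 0 < dotv p (x *m H' + z).
  move=> Kx Lp px; have := etau (x, p) (conj (conj Kx Lp) px).
  rewrite /g/= mulmxBr mul_mx_scalar !(dotvDr, dotvBr, dotvZr, dotvNr) px.
  by rewrite /c; lra.
have [t1 t10 t1P] := perturb_subset cK cL xL L0 KL posH'.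
have [t2 t20 t2P] := det_perturb_gt1 k trH'.
have [t3 t30 t3P] := det_mix_rows_neq0 H'.
have M0 : 0 < 1 + `|c| by rewrite ltr_pwDl.
(* The last bound gives [|t c| < 1], so the scalar [1 + t c] is nonzero. *)
pose t := Num.min (Num.min t1 t2) (Num.min t3 (1 + `|c|)^-1).
have t0 : 0 < t by rewrite !lt_min t10 t20 t30 invr_gt0 M0.
have /and4P[tt1 tt2 tt3 tt4] : [&& t <= t1, t <= t2, t <= t3 & t <= (1 + `|c|)^-1].
  by rewrite !ge_min !lexx !orbT.
have detA : 1 < \det (1%:M - t *: H') by apply: t2P; rewrite t0.
have FA : F_operator F (1%:M - t *: H').
  apply: (F_operator_perturb projP).
    by rewrite unitmxE unitfE gt_eqF// (lt_trans ltr01).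
  rewrite gt_eqF//; have : `|t * c| < 1.
    rewrite normrM gtr0_norm//.
    apply: (@le_lt_trans _ _ ((1 + `|c|)^-1 * `|c|)); first by rewrite ler_wpM2r.
    by rewrite mulrC ltr_pdivrMr// mul1r ltrDr.
  by rewrite ltr_norml => /andP[+ _]; lra.
have := maxK (K' := aff_image (1%:M - t *: H') (- (t *: z)) K).
rewrite vol_aff_image; last by move=> m; apply: t3P; rewrite t0.
have volK : vol K \is a fin_num.
  by rewrite ge0_fin_numE ?(vol_compact_lty k)// ltW// vol_interior_gt0.
have volK0 : 0 < fine (vol K).
  by rewrite -lte_fin fineK//; exact: vol_interior_gt0.
rewrite -(fineK volK) -EFinM lee_fin ger_pMl// gtr0_norm ?(lt_trans ltr01)//.
rewrite [_ <= 1]leNgt detA => maxA; suff : false by []; apply: maxA.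
  by exists (1%:M - t *: H'), (- (t *: z)).
move=> _ [x Kx <-].
have -> : x *m (1%:M - t *: H') - t *: z = x - t *: (x *m H' + z).
  by rewrite mulmxBr mulmx1 -scalemxAr scalerDr opprD addrA.
by apply: t1P => //; rewrite t0.
Qed.

End ContactPairs.

(** * From convex combinations to the decomposition of the identity *)

Section Decomposition.
Set Implicit Arguments.
Unset Strict Implicit.
Variable R : realType.

Lemma dotv_row_mx m n (a c : 'rV[R]_m) (b e : 'rV[R]_n) :
  dotv (row_mx a b) (row_mx c e) = dotv a c + dotv b e.
Proof.
by rewrite {1}/dotv big_split_ord/=; congr (_ + _); apply: eq_bigr => i _;
  rewrite ?row_mxEl ?row_mxEr.
Qed.

(** Identifies the trace pairing of operators with [dotv], so that the hull result for row vectors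
    applies to them. *)
Lemma dotv_mxvec m n (A B : 'M[R]_(m, n)) :
  dotv (mxvec A) (mxvec B) = \tr (A *m B^T).
Proof.
rewrite /dotv (reindex _ (curry_mxvec_bij _ _))/= /mxtrace.
rewrite (eq_bigr (fun p => A p.1 p.2 * B p.1 p.2)); last first.
  by move=> [i j] _; rewrite !mxvecE.
rewrite -(pair_bigA _ (fun i j => A i j * B i j))/=.
by apply: eq_bigr => i _; rewrite mxE; apply: eq_bigr => j _; rewrite mxE.
Qed.

(** Discards the zero weights of a convex combination, since the final weights must be positive, and
    rescales by [c]. *)
Lemma sum_positive_weights (V : lmodType R) n (a : 'I_n -> R) (c : R) (Y : 'I_n -> V) :
  (forall i, 0 <= a i) ->
  \sum_(j < #|[set i | 0 < a i]%SET|) (c * a (enum_val j)) *: Y (enum_val j) =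
  c *: \sum_i a i *: Y i.
Proof.
move=> a0; rewrite -(big_enum_val (fun i => (c * a i) *: Y i)) scaler_sumr.
rewrite [RHS](bigID (fun i => i \in [set i | 0 < a i]%SET))/= [X in _ + X]big1 ?addr0.
  by apply: eq_bigr => i _; rewrite scalerA.
move=> i; rewrite inE -leNgt => ai.
by rewrite (_ : a i = 0) ?scale0r ?scaler0//; apply/eqP; rewrite eq_le ai a0.
Qed.

End Decomposition.

Theorem mainTheorem1 (R : realType) (d : nat) (K L : set 'rV[R]_d)
  (F PF : 'M[R]_d) :
  convex_body K -> convex_body L -> K° 0 -> L° 0 -> K `<=` L ->
  orth_proj F PF ->
  (forall K', A_F F K K' -> K' `<=` L -> (vol K' <= vol K)%E) ->
  exists (m : nat) (v p : 'I_m -> 'rV[R]_d) (alpha : 'I_m -> R),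
    (forall i, contact_pair K L (v i) (p i)) /\
    (forall i, 0 < alpha i) /\
    PF *m (\sum_(i < m) alpha i *: tens (p i) (v i)) *m PF = PF /\
    \sum_(i < m) alpha i *: p i = 0 /\
    \tr (\sum_(i < m) alpha i *: tens (p i) (v i)) = d%:R /\
    \sum_(i < m) alpha i = d%:R.
Proof.
move=> bK bL K0 L0 KL projP maxK.
case: d => [|d'] in K L F PF bK bL K0 L0 KL projP maxK *.
  (* In dimension [0] the empty family works. *)
  exists 0%N, (fun=> 0), (fun=> 0), (fun=> 0); split; first by case.
  split; first by case.
  rewrite !big_ord0 mxtrace0 [PF]flatmx0 [LHS]flatmx0.
  by do 3!split.
have d0 : (d'.+1)%:R != 0 :> R by rewrite pnatr_eq0.
have PT := orth_proj_tr projP; have PP := orth_proj_idem projP.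
(* Operator and vector are packed into one row; the claim is that [tau] is in the convex hull of the
   [phi] image of the touching pairs. *)
pose phi (xp : 'rV[R]_d'.+1 * 'rV[R]_d'.+1) :=
  row_mx (mxvec (PF *m tens xp.2 xp.1 *m PF)) xp.2.
pose tau := row_mx (mxvec (d'.+1%:R^-1 *: PF)) (0 : 'rV[R]_d'.+1).
have phiE xp (H : 'M[R]_d'.+1) z : dotv (row_mx (mxvec H) z) (phi xp) =
    dotv xp.2 (xp.1 *m (PF *m H *m PF)) + dotv xp.2 z.
  rewrite dotv_row_mx (dotvC z); congr (_ + _).
  rewrite dotv_mxvec !trmx_mul PT trmxK !mulmxA.
  rewrite [LHS]mxtrace_mulC !mulmxA mxtrace_mulC [X in \tr X]mx11_scalar mxtrace_scalar.
  by rewrite dotvC dotv_mulmx !mulmxA.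
have tauE (H : 'M[R]_d'.+1) z : dotv (row_mx (mxvec H) z) tau =
    \tr (PF *m H *m PF) / d'.+1%:R.
  rewrite dotv_row_mx [dotv z _]dotvC dotv0l addr0 dotv_mxvec linearZ/= PT.
  rewrite -scalemxAr mxtraceZ mulrC; congr (_ * _).
  by rewrite [RHS]mxtrace_mulC mulmxA PP mxtrace_mulC.
have cphi : compact (phi @` touching K L).
  apply: continuous_compact; last exact: compact_touching.
  apply: continuous_subspaceT; apply: continuous_rV => i.
  have c1 : continuous (fun xp : 'rV[R]_d'.+1 * 'rV[R]_d'.+1 => xp.1).
    by move=> xp; exact: cvg_fst.
  have c2 : continuous (fun xp : 'rV[R]_d'.+1 * 'rV[R]_d'.+1 => xp.2).
    by move=> xp; exact: cvg_snd.
  case: (split_ordP i) => j ->; last first.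
    under eq_fun do rewrite row_mxEr.
    exact: continuous_coord.
  case/mxvec_indexP: j => l m.
  (* As [PF] is symmetric, the compressed operator is the rank-one product of the projected
     vectors. *)
  rewrite (_ : (fun _ => _) = fun xp => (xp.1 *m PF) 0 l * (xp.2 *m PF) 0 m).
    have cm m' (f : _ -> 'rV[R]_d'.+1) : continuous f ->
        continuous (fun xp : 'rV[R]_d'.+1 * 'rV[R]_d'.+1 => (f xp *m PF) 0 m').
      by move=> cf; apply: continuous_coord; exact: continuous_mulmx.
    by move=> xp; apply: cvgM; exact: cm.
  apply/funext => xp; rewrite row_mxEl mxvecE /tens !mulmxA -mulmxA mxE big_ord1.
  by congr (_ * _); rewrite -[PF *m _]trmxK trmx_mul trmxK PT mxE.
have [h|a [X [a0 a1 SX tauX]]] := @hull_of_support _ _ (phi @` touching K L) tau cphi.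
  (* Every functional [h] splits into a matrix part and a vector part. *)
  have [xp txp H] := touching_below bK bL K0 L0 KL (@ord0 d') projP maxK
    (vec_mx (lsubmx h)) (rsubmx h).
  exists (phi xp); first by exists xp.
  by rewrite -(hsubmxK h) -(vec_mxK (lsubmx h)) phiE tauE.
have /choice[xp xpP] : forall i, exists xp, touching K L xp /\ phi xp = X i.
  by move=> i; have [xp] := SX i; exists xp.
(* The convex weights sum to [1]; multiplying by the dimension yields total weight [d] and turns
   [PF / d] into [PF]. *)
exists #|[set i | 0 < a i]%SET|, (fun j => (xp (enum_val j)).1),
  (fun j => (xp (enum_val j)).2), (fun j => d'.+1%:R * a (enum_val j)).
have sumT : \sum_i a i *: (PF *m tens (xp i).2 (xp i).1 *m PF) = d'.+1%:R^-1 *: PF.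
  have := congr1 lsubmx tauX; rewrite row_mxKl linear_sum/= => /(congr1 vec_mx).
  rewrite mxvecK linear_sum/= => ->; apply: eq_bigr => i _.
  by rewrite -(xpP i).2 !linearZ/= row_mxKl mxvecK.
have sump : \sum_i a i *: (xp i).2 = 0.
  have := congr1 rsubmx tauX; rewrite row_mxKr linear_sum/= => sum0.
  by rewrite [RHS]sum0; apply: eq_bigr => i _; rewrite -(xpP i).2 linearZ/= row_mxKr.
have sum1 : \sum_(j < #|[set i | 0 < a i]%SET|) d'.+1%:R * a (enum_val j) = d'.+1%:R.
  have := @sum_positive_weights R R^o _ a d'.+1%:R (fun=> 1) a0.
  rewrite /GRing.scale/=; under eq_bigr do rewrite mulr1.
  by move=> ->; under eq_bigr do rewrite mulr1; rewrite a1 mulr1.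
split.
  by move=> j; apply: contact_pair_touching => //; rewrite -surjective_pairing; exact: (xpP _).1.
split.
  by move=> j; rewrite mulr_gt0 ?ltr0n//; have := enum_valP j; rewrite inE.
split; [|split; [|split]].
- rewrite mulmx_sumr mulmx_suml.
  rewrite (eq_bigr (fun j => (d'.+1%:R * a (enum_val j)) *:
    (PF *m tens (xp (enum_val j)).2 (xp (enum_val j)).1 *m PF))); last first.
    by move=> j _; rewrite -scalemxAr -scalemxAl.
  rewrite (@sum_positive_weights R _ _ a _
    (fun i => PF *m tens (xp i).2 (xp i).1 *m PF))// sumT.
  by rewrite scalerA divff// scale1r.
- by rewrite (@sum_positive_weights R _ _ a _ (fun i => (xp i).2))// sump scaler0.
(* Each rank-one operator has trace [<p, v> = 1], so the trace equals the total weight. *)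
- rewrite raddf_sum/= -[RHS]sum1; apply: eq_bigr => j _; rewrite mxtraceZ.
  rewrite /tens mxtrace_mulC [X in \tr X]mx11_scalar mxtrace_scalar -dotv_mulmx.
  by have [[_ ->] _] := xpP (enum_val j); rewrite mulr1.
- exact: sum1.
Qed.
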